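(* Let $\mathcal H$ be a real Hilbert space, let $m$ be a strictly positive integer, and let $(\omega_i)_{1\leq i\leq m}\in\,]0,1]^m$ satisfy $\sum_{i=1}^m\omega_i=1$. For every $i\in\{0,\ldots,m\}$, let $T_i\colon\mathcal H\to\mathcal H$ be $\alpha_i$-averaged for some $\alpha_i\in\,]0,1[$. A point of $\operatorname{Fix}\big(T_0\circ\sum_{i=1}^m\omega_iT_i\big)$ is called a solution; assume that a solution exists. Let $K$ be a strictly positive integer and let $(I_n)_{n\in\mathbb N}$ be a sequence of nonempty subsets of $\{1,\ldots,m\}$ such that $\bigcup_{k=0}^{K-1}I_{n+k}=\{1,\ldots,m\}$ for every $n\in\mathbb N$. For every integer $n\geq K-1$ and every $i\in\{1,\ldots,m\}$, set $\ell_i(n)=\max\{k\in\{n-K+1,\ldots,n\}\mid i\in I_k\}$. Let $(e_{0,n})_{n\in\mathbb N},\ldots,(e_{m,n})_{n\in\mathbb N}$ be sequences in $\mathcal H$ such that $\sum_{n\geq K-1}\|e_{0,n}\|<+\infty$ and, for every $i\in\{1,\ldots,m\}$, $\sum_{n\geq K-1}\|e_{i,\ell_i(n)}\|<+\infty$. Let $x_0\in\mathcal H$, let $(t_{i,-1})_{1\leq i\leq m}\in\mathcal H^m$, and define iteratively, for $n=0,1,\ldots$, $$t_{i,n}=\begin{cases}T_ix_n+e_{i,n},&\text{if } i\in I_n;\\ t_{i,n-1},&\text{if } i\in\{1,\ldots,m\}\smallsetminus I_n,\end{cases}\qquad x_{n+1}=T_0\Big(\sum_{i=1}^m\omega_it_{i,n}\Big)+e_{0,n}.$$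 Then the following hold: (i) Let $x$ be a solution and let $i\in\{1,\ldots,m\}$. Then $x_n-T_ix_n\to x-T_ix$ (in norm). (ii) $(x_n)_{n\in\mathbb N}$ converges weakly to a solution. (iii) Suppose that, for some $i\in\{0,\ldots,m\}$, $T_i$ is demicompact. Then $(x_n)_{n\in\mathbb N}$ converges strongly to a solution. (iv) Suppose that the iteration is implemented without errors (all $e_{i,n}=0$) and that, for some $i\in\{0,\ldots,m\}$, $T_i$ is a Banach contraction. Then $(x_n)_{n\in\mathbb N}$ converges linearly to the unique solution.
   Context: An operator $T\colon\mathcal H\to\mathcal H$ is nonexpansive if it is $1$-Lipschitzian; it is $\alpha$-averaged, for $\alpha\in\,]0,1[$, if $\operatorname{Id}+\alpha^{-1}(T-\operatorname{Id})$ is nonexpansive; it is a Banach contraction if it is Lipschitzian with a constant strictly less than $1$. $\operatorname{Fix}T$ is the set of fixed points of $T$. An operator $T\colon\mathcal H\to\mathcal H$ is demicompact if every bounded sequence $(y_n)_{n\in\mathbb N}$ in $\mathcal H$ such that $(y_n-Ty_n)_{n\in\mathbb N}$ converges (strongly) has a strong sequential cluster point, i.e., a norm-convergent subsequence. Linear convergence of $(x_n)_{n\in\mathbb N}$ to $x$ means that there exist $c\geq 0$ and $r\in\,]0,1[$ such that $\|x_n-x\|\leq c\,r^n$ for every $n\in\mathbb N$. *)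

(* Defs.v *)
From HB Require Import structures.
From mathcomp Require Export all_boot all_order all_algebra.
From mathcomp Require Export all_classical all_reals all_analysis.

Set Implicit Arguments.
Unset Strict Implicit.
Unset Printing Implicit Defensive.

Export Order.TTheory GRing.Theory Num.Theory.
Export numFieldNormedType.Exports.

Local Open Scope classical_set_scope.
Local Open Scope ring_scope.

(* A real Hilbert space is a complete normed module whose norm is induced by
   the inner product [dot]. *)
Definition is_hilbert (R : realType) (H : completeNormedModType R)
    (dot : {dot H for idfun}) : Prop :=
  forall x : H, `|x| ^+ 2 = dot x x.

Definition fixed_points (T : Type) (f : T -> T) : set T := [set x | f x = x].

Section operators.
Variables (R : realType) (H : normedModType R).
Implicit Types (T : H -> H) (u : nat -> H) (x : H).

Definition nonexpansive T : Prop := 1.-lipschitz T.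

Definition averaged (a : R) T : Prop :=
  0 < a < 1 /\ nonexpansive (fun x => x + a^-1 *: (T x - x)).

Definition banach_contraction T : Prop :=
  exists2 k : R, 0 <= k < 1 & k.-lipschitz T.

Definition demicompact T : Prop :=
  forall y : nat -> H, bounded_fun y -> cvgn (fun n => y n - T (y n)) ->
    exists2 phi : nat -> nat, increasing_seq phi & cvgn (y \o phi).

Definition linear_cvg u x : Prop :=
  exists c r : R,
    [/\ 0 <= c, 0 < r < 1 & forall n, `|u n - x| <= c * r ^+ n].

End operators.

Definition weak_cvg (R : realType) (H : completeNormedModType R)
    (dot : {dot H for idfun}) (u : nat -> H) (x : H) : Prop :=
  forall y : H, dot (u n) y @[n --> \oo] --> dot x y.

Section problem.
Variables (R : realType) (H : normedModType R) (m : nat).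

(* The indices 0, ..., m of the operators form ['I_m.+1]; the index i in
   {1, ..., m} is [lift ord0 j], of value j + 1, for the ordinal j : 'I_m. *)
Definition solutions (T : 'I_m.+1 -> H -> H) (omega : 'I_m -> R) : set H :=
  fixed_points
    (T ord0 \o (fun x => \sum_(i < m) omega i *: T (lift ord0 i) x)).

(* Last activation of index i in {n-K+1, ..., n}. Meaningful for n >= K-1, when
   the truncated subtraction is exact, and when i is activated at least once in
   that window. *)
Definition last_activation (K : nat) (I : nat -> {set 'I_m}) (i : 'I_m)
    (n : nat) : nat :=
  (\max_(n.+1 - K <= k < n.+1 | i \in I k) k)%N.

Definition is_iteration (T : 'I_m.+1 -> H -> H) (omega : 'I_m -> R)
    (I : nat -> {set 'I_m}) (e : 'I_m.+1 -> nat -> H)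
    (x0 : H) (tinit : 'I_m -> H) (* tinit i is t_{i,-1} *)
    (t : 'I_m -> nat -> H) (x : nat -> H) : Prop :=
  [/\ x 0%N = x0,
      forall n i, t i n =
        if i \in I n then T (lift ord0 i) (x n) + e (lift ord0 i) n
        else if n is n'.+1 then t i n' else tinit i
    & forall n, x n.+1 = T ord0 (\sum_(i < m) omega i *: t i n) + e ord0 n].

End problem.

(* Main.v *)
Require Import Defs.
From mathcomp Require Import ring lra zify.

Set Implicit Arguments.
Unset Strict Implicit.
Unset Printing Implicit Defensive.

Local Open Scope classical_set_scope.
Local Open Scope ring_scope.

(* Fix a solution z and write a_n = |x_n - z|. Nonexpansiveness bounds a_(n+1)
   by a convex combination of the last K values of a, up to a summable error,
   and a_n enters with weight at least min omega > 0 because I_n is nonempty;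
   hence a_n converges. Feeding this back into the averagedness inequalities,
   every nonnegative term they contain tends to 0, including the variance of
   the points T_i x_(l_i(n)) - T_i z. Since some l_i(n) equals n, this forces
   x_(l_i(n)) - x_n -> 0, which gives (i) and x_n - F x_n -> 0, where F is the
   operator whose fixed points are the solutions.

   Weak convergence avoids weak compactness: every bounded sequence has an
   asymptotic center, the unique minimizer c of limsup |u_n - c|^2. For x and
   its subsequences the center is a fixed point of F, hence the same for all of
   them by convergence of |x_n - c|, and a sequence all of whose subsequences
   have the center c converges weakly to c. *)

(** * Sequences *)

Lemma cvgn_oo_ge (phi : nat -> nat) :
  (forall n, (n <= phi n)%N) -> phi n @[n --> \oo] --> \oo.
Proof.
move=> phi_ge A [N _ NA]; exists N => // n /= Nn.
by apply: NA; exact: leq_trans (phi_ge n).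
Qed.

Lemma increasing_seq_ge (phi : nat -> nat) :
  increasing_seq phi -> forall n, (n <= phi n)%N.
Proof.
move=> /increasing_seqP phiS; elim=> // n IH.
exact: leq_ltn_trans IH (phiS n).
Qed.

Lemma cvgn_ext (R : realType) (V : normedModType R) (u v : nat -> V) (a b : V) :
  u @ \oo --> a -> (forall n, v n = u n) -> b = a -> v @ \oo --> b.
Proof. by move=> ua /funext -> ->. Qed.

Lemma cvg_sqr (R : realType) (a : nat -> R) (l : R) :
  a @ \oo --> l -> a n ^+ 2 @[n --> \oo] --> l ^+ 2.
Proof.
by move=> al; under eq_fun do rewrite expr2; rewrite expr2; exact: cvgM.
Qed.

Lemma cvgn_bounded (R : realType) (a : nat -> R) :
  cvgn a -> exists M, forall n, a n <= M.
Proof.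
move=> /cvg_seq_bounded/bounded_fun_has_ubound[M aM].
by exists M => n; apply: aM; exists n.
Qed.

(** Tail sums turn each error into a decrement of [s], the form that [window_cvg] absorbs. Freezing
    [s] below [N] keeps it finite and nonincreasing there. *)
Lemma summable_tails (R : realType) (f : nat -> R) (N : nat) :
  (forall n, 0 <= f n) -> (\sum_(N <= n <oo) (f n)%:E < +oo)%E ->
  exists s : nat -> R, [/\ nonincreasing_seq s, forall n, 0 <= s n
    & forall n, (N <= n)%N -> s n.+1 + f n = s n].
Proof.
move=> f0 fN.
pose g := fun n => (\sum_(n <= k <oo) (f k)%:E)%E.
have g0 n : (0 <= g n)%E by apply: nneseries_ge0 => k _ _; rewrite lee_fin.
have gS n : g n = ((f n)%:E + g n.+1)%E.
  rewrite /g (@nneseries_split _ (fun k => (f k)%:E) n 1) => [|k _]; last first.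
    by rewrite lee_fin.
  by rewrite addn1 big_nat1.
have gfin n : (N <= n)%N -> g n \is a fin_num.
  elim: n => [|n IH].
    by rewrite leqn0 => /eqP N0; rewrite ge0_fin_numE -?N0.
  rewrite leq_eqVlt => /predU1P[<-|]; first by rewrite ge0_fin_numE.
  by rewrite ltnS => /IH; rewrite gS fin_numD => /andP[].
have sE n : (N <= n)%N -> fine (g n.+1) + f n = fine (g n).
  by move=> Nn; rewrite [in RHS]gS fineD ?gfin ?(leq_trans Nn) //= addrC.
exists (fun n => fine (g (maxn N n))); split => [|n|n Nn] /=.
- apply/nonincreasing_seqP => n /=; have [nN|Nn] := ltnP n N.
    by rewrite (maxn_idPl nN).
  by rewrite (maxn_idPr _) ?(leq_trans Nn) // -[leRHS]sE // lerDl.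
- exact: fine_ge0.
- by rewrite (maxn_idPr _) ?(leq_trans Nn) // (maxn_idPr Nn) sE.
Qed.

(* With M_n the maximum of a over the window n, ..., n + K, which is
   nonincreasing, iterating the hypothesis gives
   M_(n+K) <= M_n - w ^ K (M_n - a_(n+K)), so a has the same limit as M. *)
Lemma window_cvg_exact (R : realType) (K : nat) (w : R) (a : nat -> R) :
  0 < w <= 1 -> (forall n, 0 <= a n) ->
  (forall n B, (forall k, (k <= K)%N -> a (n + k)%N <= B) ->
     a (n + K).+1 <= w * a (n + K)%N + (1 - w) * B) ->
  cvgn a.
Proof.
move=> /andP[w0 w1] a0 step.
pose M n := \big[Num.max/a n]_(k < K.+1) a (n + k)%N.
have le_M n k : (k <= K)%N -> a (n + k)%N <= M n.
  rewrite -ltnS => kK.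
  exact: (le_bigmax _ (fun j : 'I_K.+1 => a (n + j)%N) (Ordinal kK)).
have M_le n B : (forall k, (k <= K)%N -> a (n + k)%N <= B) -> M n <= B.
  move=> aB; apply: bigmax_le => [|k _]; last by apply: aB; rewrite -ltnS.
  by rewrite -[n]addn0 aB.
have aM n : a n <= M n by rewrite -[n in a n]addn0 le_M.
have stepM n : a (n + K).+1 <= M n.
  apply: (le_trans (step _ _ (le_M n))).
  by have := le_M n K (leqnn K); nra.
have M_S n : M n.+1 <= M n.
  apply: M_le => k; rewrite leq_eqVlt => /predU1P[->|kK].
    by rewrite addSn stepM.
  by rewrite addSnnS le_M.
have M_mono : nonincreasing_seq M by apply/nonincreasing_seqP.
have drop n j : a (n + K + j)%N <= M n - w ^+ j * (M n - a (n + K)%N).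
  elim: j => [|j IH]; first by rewrite addn0 expr0; lra.
  have := step (n + j)%N (M n).
  rewrite [(n + j + K)%N]addnAC addnS => /(_ _) /le_trans; apply => [k kK|].
    by apply: le_trans (le_M _ _ kK) (M_mono _ _ (leq_addr _ _)).
  by rewrite exprS; nra.
have gap n : M n - a (n + K)%N <= (w ^+ K)^-1 * (M n - M (n + K)%N).
  rewrite mulrC ler_pdivlMr ?exprn_gt0 // lerBrDr -lerBrDl mulrC.
  apply: M_le => k kK; apply: (le_trans (drop n k)).
  rewrite lerD2l lerN2 ler_wpM2r ?subr_ge0 ?le_M //.
  by apply: ler_wiXn2l => //; exact: ltW.
have Mc : cvgn M.
  apply: nonincreasing_is_cvgn => //.
  by exists 0 => _ [n _ <-]; exact: le_trans (a0 n) (aM n).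
apply/cvg_ex; exists (limn M); rewrite -(cvg_shiftn K).
have H0 : (w ^+ K)^-1 * (M n - M (n + K)%N) @[n --> \oo] --> 0.
  rewrite -[X in _ --> X](mulr0 (w ^+ K)^-1); apply: cvgMr.
  rewrite -(subrr (limn M)); apply: cvgB => //.
  by rewrite (cvg_shiftn K).
apply: (@squeeze_cvgr _ _ _ _
  (fun n => M n - (w ^+ K)^-1 * (M n - M (n + K)%N)) M) => //.
  by near=> n; rewrite le_M // andbT lerBlDr -lerBlDl gap.
by rewrite -[X in _ --> X]subr0; apply: cvgB.
Unshelve. all: end_near. Qed.

(** The sequence [a + s] satisfies the error-free recursion: if it is at most [B] on the window,
    then [a (n + k) <= B - s (n + K)] there because [s] is nonincreasing. *)
Lemma window_cvg (R : realType) (K : nat) (w : R) (a s : nat -> R) :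
  0 < w <= 1 -> (forall n, 0 <= a n) ->
  nonincreasing_seq s -> (forall n, 0 <= s n) ->
  (forall n B, (forall k, (k <= K)%N -> a (n + k)%N <= B) ->
     a (n + K).+1 <=
       w * a (n + K)%N + (1 - w) * B + (s (n + K)%N - s (n + K).+1)) ->
  cvgn a.
Proof.
move=> w01 a0 s_mono s0 step.
have s_cvg : cvgn s.
  by apply: nonincreasing_is_cvgn => //; exists 0 => _ [n _ <-].
have -> : a = (a \+ s) \- s by apply/funext => n /=; rewrite addrK.
apply: is_cvgB => //; apply: (@window_cvg_exact _ K w) => // [n|n B aB] /=.
  by rewrite addr_ge0.
have := step n (B - s (n + K)%N) => /(_ _) st.
have {}st := st _; rewrite -lerBrDr; apply: (le_trans (st _)) => [k kK|].
  have := aB k kK.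
  have : s (n + K)%N <= s (n + k)%N by apply: s_mono; rewrite leq_add2l.
  by rewrite /=; lra.
by lra.
Qed.

Lemma bernoulli_sub (R : realType) (t : R) (n : nat) :
  0 <= t <= 1 -> 1 - n%:R * t <= (1 - t) ^+ n.
Proof.
move=> /andP[t0 t1]; elim: n => [|n IH]; first by rewrite expr0; lra.
have n0 : 0 <= n%:R :> R by [].
rewrite exprS -natr1.
have : (1 - t) * (1 - n%:R * t) <= (1 - t) * (1 - t) ^+ n.
  by rewrite ler_wpM2l ?subr_ge0.
have : 0 <= n%:R * (t * t) by rewrite !mulr_ge0.
by lra.
Qed.

(* The rate r = 1 - (1 - k') / (K + 1), where k' = max(k, 1/2) keeps r positive,
   satisfies k <= r ^ (K + 1) by Bernoulli's inequality. *)
Lemma window_linear (R : realType) (K : nat) (k : R) (a : nat -> R) :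
  0 <= k < 1 -> (forall n, 0 <= a n) ->
  (forall n B, (forall j, (j <= K)%N -> a (n + j)%N <= B) ->
     a (n + K).+1 <= k * B) ->
  exists c r : R, [/\ 0 <= c, 0 < r < 1 & forall n, a n <= c * r ^+ n].
Proof.
move=> /andP[k0 k1] a0 step; pose k' := Num.max k 2^-1.
have k'0 : 0 < k' by rewrite lt_max invr_gt0 ltr0n orbT.
have k'1 : k' < 1 by rewrite gt_max k1 /=; lra.
pose t := (1 - k') / K.+1%:R.
have t0 : 0 < t by rewrite divr_gt0 ?subr_gt0.
have tK : t * K.+1%:R = 1 - k' by rewrite /t divfK.
have t1 : t < 1.
  apply: (@le_lt_trans _ _ (1 - k')); last by lra.
  by rewrite -tK ler_peMr ?ler1n // ltW.
pose r := 1 - t.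
have r0 : 0 < r by rewrite subr_gt0.
have r1 : r < 1 by rewrite /r; lra.
have kr : k <= r ^+ K.+1.
  have : 0 <= t <= 1 by rewrite !ltW.
  move=> /(bernoulli_sub K.+1); apply: le_trans.
  by rewrite mulrC tK opprB addrC subrK le_max lexx.
pose S := \sum_(j < K.+1) a j.
have S0 : 0 <= S by rewrite sumr_ge0.
(* [S] dominates the first [K + 1] terms of [a], and [r ^ n >= r ^ K] for [n <= K], so this constant
   settles the base cases. *)
have c0 : 0 <= S / r ^+ K by rewrite divr_ge0 // exprn_ge0 // ltW.
exists (S / r ^+ K), r.
split => //; first by rewrite r0.
elim/ltn_ind => n IH; have [nK|Kn] := leqP n K.
  apply: (@le_trans _ _ S).
    by rewrite /S (bigD1 (Ordinal (nK : (n < K.+1)%N))) //= lerDl sumr_ge0.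
  rewrite mulrAC ler_pdivlMr ?exprn_gt0 // ler_wpM2l //.
  by rewrite ler_wiXn2l // ltW.
have -> : n = ((n - K.+1) + K).+1 by lia.
apply: (@le_trans _ _ (k * (S / r ^+ K * r ^+ (n - K.+1)))).
  apply: step => j jK; apply: (le_trans (IH _ _)); first by lia.
  rewrite ler_wpM2l // ler_wiXn2l ?leq_addr //; exact: ltW.
rewrite -addnS exprD mulrC [leRHS]mulrA ler_wpM2l //.
by apply: mulr_ge0 => //; apply: exprn_ge0; exact: ltW.
Qed.

(** * Asymptotic centers and weak convergence *)

(** The bound on [b ^ 2] also bounds [b], so [d] can be chosen uniformly: squaring costs at most
    [d * (2 * b + d) <= d * C]. *)
Lemma sqr_perturb (R : realType) (rho eps : R) : 0 <= rho -> 0 < eps ->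
  exists2 d, 0 < d & forall a b : R, 0 <= a -> 0 <= b -> a <= b + d ->
    b ^+ 2 <= rho + eps / 2 -> a ^+ 2 <= rho + eps.
Proof.
move=> rho0 eps0; pose C := 2 * (rho + eps + 1) + 1.
have C0 : 0 < C by rewrite /C; lra.
exists (Num.min 1 (eps / 2 / C)) => [|a b a0 b0].
  by rewrite lt_min ltr01 !divr_gt0.
set d := Num.min _ _; move=> abd b2.
have d0 : 0 < d by rewrite lt_min ltr01 !divr_gt0.
have d1 : d <= 1 by rewrite ge_min lexx.
have dC : d * C <= eps / 2 by rewrite -ler_pdivlMr // ge_min lexx orbT.
have bC : b <= rho + eps + 1 by nra.
have : a ^+ 2 <= (b + d) ^+ 2 by rewrite ler_sqr ?nnegrE // addr_ge0 // ltW.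
have : d * (2 * b + d) <= d * C by rewrite ler_pM2l // /C; lra.
by rewrite expr2 sqrrD; lra.
Qed.

Section hilbert.
Variables (R : realType) (H : completeNormedModType R) (dot : {dot H for idfun}).
Hypothesis H_hilbert : is_hilbert dot.
Implicit Types (u v : nat -> H) (x y z : H).

Lemma dotC x y : dot x y = dot y x.
Proof. by rewrite hermC expr0 mul1r. Qed.

Lemma normsqD x y : `|x + y| ^+ 2 = `|x| ^+ 2 + 2 * dot x y + `|y| ^+ 2.
Proof. by rewrite !H_hilbert linearDl !linearDr /= (dotC y x); ring. Qed.

Lemma normsqB x y : `|x - y| ^+ 2 = `|x| ^+ 2 - 2 * dot x y + `|y| ^+ 2.
Proof. by rewrite normsqD linearNr normrN; ring. Qed.

Lemma normsqZ (a : R) x : `|a *: x| ^+ 2 = a ^+ 2 * `|x| ^+ 2.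
Proof. by rewrite normrZ exprMn real_normK ?num_real. Qed.

Lemma normsq_mid x y z :
  `|x - 2^-1 *: (y + z)| ^+ 2 =
  (`|x - y| ^+ 2 + `|x - z| ^+ 2) / 2 - `|y - z| ^+ 2 / 4.
Proof.
rewrite !normsqB normsqZ normsqD linearZr_LR linearDr /=.
by field.
Qed.

(* x minimizes y |-> limsup |u n - y|^2, with minimum r; the quadratic growth
   term, due to the parallelogram law, is what makes x unique. *)
Definition asymptotic_center u x (r : R) : Prop :=
  (forall eps, 0 < eps -> \forall n \near \oo, `|u n - x| ^+ 2 <= r + eps) /\
  (forall y b, (\forall n \near \oo, `|u n - y| ^+ 2 <= b) ->
    r + `|y - x| ^+ 2 / 2 <= b).

Lemma asymptotic_center_ge0 u x r : asymptotic_center u x r -> 0 <= r.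
Proof.
move=> [rP _]; apply/ler_addgt0Pr => eps eps0.
have [n] := filter_ex (rP _ eps0); apply: le_trans.
exact: sqr_ge0.
Qed.

(** Direct method: by the parallelogram law near-minimizers form a Cauchy sequence, whose limit is
    the center. *)
Lemma exists_asymptotic_center u (M : R) : (forall n, `|u n| <= M) ->
  exists x r, asymptotic_center u x r.
Proof.
move=> uM.
pose S := [set b : R | exists y, \forall n \near \oo, `|u n - y| ^+ 2 <= b].
have S0 b : S b -> 0 <= b.
  by move=> [y /filter_ex[n]]; apply: le_trans; exact: sqr_ge0.
have infS : has_inf S.
  split; last by exists 0 => b /S0.
  exists (M ^+ 2), 0; near=> n.
  rewrite subr0 ler_sqr ?nnegrE //.
  exact: le_trans (normr_ge0 _) (uM 0%N).
pose rho : R := inf S.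
have rho_le b : S b -> rho <= b by move=> Sb; apply: ge_inf => //; case: infS.
(* The midpoint of [y] and [z] competes in the infimum [rho]. *)
have key y z b1 b2 : (\forall n \near \oo, `|u n - y| ^+ 2 <= b1) ->
    (\forall n \near \oo, `|u n - z| ^+ 2 <= b2) ->
    rho + `|y - z| ^+ 2 / 4 <= (b1 + b2) / 2.
  move=> yb zb; rewrite -lerBrDr; apply: rho_le; exists (2^-1 *: (y + z)).
  near=> n; rewrite normsq_mid.
  have : `|u n - y| ^+ 2 <= b1 by near: n.
  have : `|u n - z| ^+ 2 <= b2 by near: n.
  by lra.
have /choice[y_ y_P] : forall k : nat, exists y,
    \forall n \near \oo, `|u n - y| ^+ 2 <= rho + k.+1%:R^-1.
  move=> k.
  have k0 : 0 < k.+1%:R^-1 :> R by rewrite invr_gt0.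
  have [b [y yb] brho] := inf_adherent k0 infS.
  exists y; near=> n; apply: (@le_trans _ _ b); last exact: ltW.
  by near: n.
have y_cvg : cvgn y_.
  apply/cauchy_cvgP/cauchy_exP => e e0.
  have [k kP] : exists k : nat, forall l, (k <= l)%N -> l.+1%:R^-1 < e ^+ 2 / 4 :> R.
    have e40 : 0 < e ^+ 2 / 4 by rewrite divr_gt0 ?exprn_gt0.
    have [k _ kP] := near_infty_natSinv_lt (PosNum e40).
    by exists k.
  exists (y_ k); exists k => // l /= kl.
  rewrite -ball_normE /= -ltr_sqr ?nnegrE ?(ltW e0) //.
  have := key _ _ _ _ (y_P k) (y_P l).
  have := kP _ (leqnn k); have := kP _ kl => /=.
  by move: (l.+1%:R^-1) (k.+1%:R^-1) => p q; lra.
pose x := limn y_.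
have xP eps : 0 < eps -> \forall n \near \oo, `|u n - x| ^+ 2 <= rho + eps.
  move=> eps0; have rho0 : 0 <= rho by apply: lb_le_inf; [case: infS|move=> b /S0].
  have [d d0 dP] := sqr_perturb rho0 eps0.
  have [k [kd ke]] : exists k : nat, `|x - y_ k| <= d /\ k.+1%:R^-1 <= eps / 2 :> R.
    have e20 : 0 < eps / 2 by rewrite divr_gt0.
    have kP := near_infty_natSinv_lt (PosNum e20).
    have /cvgrPdist_le /(_ d d0) xk := y_cvg.
    apply: (@filter_ex _ \oo); near=> k; split; first by near: k.
    by apply: ltW; near: k.
  near=> n; apply: (dP _ `|u n - y_ k|) => //.
    by rewrite -(subrKA (y_ k)) (le_trans (ler_normD _ _)) // lerD2l distrC.
  apply: (@le_trans _ _ (rho + k.+1%:R^-1)); last by rewrite lerD2l.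
  by near: n.
exists x, rho; split=> // y b yb; apply/ler_addgt0Pr => eps eps0.
(* Doubling the midpoint estimate turns its coefficient 1/4 into the required 1/2. *)
have := key _ _ _ _ yb (xP _ eps0).
by lra.
Unshelve. all: end_near. Qed.

(** [F x] does asymptotically as well as [x], since [|u n - F x| <= |u n - F (u n)| + |u n - x|];
    quadratic growth at the center then forces [F x = x]. *)
Lemma asymptotic_center_fixed (F : H -> H) u x r :
  nonexpansive F -> (fun n => u n - F (u n)) @ \oo --> 0 ->
  asymptotic_center u x r -> F x = x.
Proof.
move=> F1 uF xr; have r0 := asymptotic_center_ge0 xr; case: xr => xP xmin.
apply/eqP; rewrite -subr_eq0 -normr_eq0 -sqrf_eq0 eq_le sqr_ge0 andbT.
suff : r + `|F x - x| ^+ 2 / 2 <= r by lra.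
apply/ler_addgt0Pr => eps eps0; apply: xmin.
have [d d0 dP] := sqr_perturb r0 eps0.
have e20 : 0 < eps / 2 by rewrite divr_gt0.
near=> n; apply: (dP _ `|u n - x|) => //; last by near: n; exact: xP.
rewrite -(subrKA (F (u n))) addrC (le_trans (ler_normD _ _)) // lerD //.
  by have := F1 (u n, x) (conj Logic.I Logic.I); rewrite /= mul1r.
by near: n; move/cvgr0Pnorm_le: uF; apply.
Unshelve. all: end_near. Qed.

Lemma weak_cvg_of_fejer (F : H -> H) u (M : R) :
  nonexpansive F -> (forall n, `|u n| <= M) ->
  (fun n => u n - F (u n)) @ \oo --> 0 ->
  (forall z, F z = z -> cvgn (fun n => `|u n - z|)) ->
  exists2 z, F z = z & weak_cvg dot u z.
Proof.
move=> F1 uM uF fejer.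
have [c [r cr]] := exists_asymptotic_center uM.
have Fc := asymptotic_center_fixed F1 uF cr.
exists c => // y.
(* Used for both [y] and [- y]. *)
suff one_sided y' eps : 0 < eps -> \forall n \near \oo, dot (u n - c) y' <= eps.
  apply/cvgrPdist_le => eps eps0; near=> n.
  rewrite distrC -linearBl ler_norml lerNl -linearNr; apply/andP; split.
    by near: n; exact: one_sided.
  by near: n; exact: one_sided.
move=> eps0; apply: contrapT => nP.
(* Failure of the bound yields arbitrarily late indices violating it; only the divergence of [phi]
   matters, not its monotonicity. *)
have /choice[phi phiP] : forall N : nat, exists n : nat,
    (N <= n)%N /\ eps < dot (u n - c) y'.
  move=> N.
  apply: contrapT => nex; apply: nP; exists N => // n /= Nn.
  by rewrite leNgt; apply/negP => lt; apply: nex; exists n.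
have phi_oo : phi n @[n --> \oo] --> \oo.
  by apply: cvgn_oo_ge => N; case: (phiP N).
pose v n := u (phi n).
have vF : (fun n => v n - F (v n)) @ \oo --> 0.
  exact: (cvg_comp _ _ phi_oo uF).
have [c' [r' cr']] := exists_asymptotic_center (fun n => uM (phi n) : `|v n| <= M).
have Fc' := asymptotic_center_fixed F1 vF cr'.
have along z : F z = z -> exists2 l, `|u n - z| ^+ 2 @[n --> \oo] --> (l : R) &
    `|v n - z| ^+ 2 @[n --> \oo] --> l.
  move=> /fejer zc; exists (limn (fun n => `|u n - z|) ^+ 2).
    exact: cvg_sqr.
  apply: (cvg_comp phi (fun n => `|u n - z| ^+ 2) phi_oo).
  exact: cvg_sqr.
have center_le w z s b l : asymptotic_center w z s ->
    `|w n - b| ^+ 2 @[n --> \oo] --> l -> s + `|b - z| ^+ 2 / 2 <= l.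
  move=> [_ smin] wl; apply/ler_addgt0Pr => e e0; apply: smin.
  near=> n; near: n; apply: (cvgr_le _ wl).
  by rewrite ltrDl.
have center_ge w z s l : asymptotic_center w z s ->
    `|w n - z| ^+ 2 @[n --> \oo] --> l -> l <= s.
  move=> [sP _] wl; apply/ler_addgt0Pr => e e0.
  rewrite -(cvg_lim (@Rhausdorff R) wl); apply: limr_le; first exact: cvgP wl.
  exact: sP.
have [l ul vl] := along c Fc; have [l' ul' vl'] := along c' Fc'.
(* As [u] and [v] share the limits [l] and [l'], one gets [r + |c' - c|^2 / 2 <= l' <= r'] and
   [r' + |c - c'|^2 / 2 <= l <= r]; summing gives [c' = c]. *)
have ec : c' = c.
  apply/eqP; rewrite -subr_eq0 -normr_eq0 -sqrf_eq0 eq_le sqr_ge0 andbT.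
  have := center_le _ _ _ _ _ cr ul'; have := center_ge _ _ _ _ cr' vl'.
  have := center_le _ _ _ _ _ cr' vl; have := center_ge _ _ _ _ cr ul.
  have := sqr_ge0 `|c - c'|.
  by lra.
rewrite {}ec {c' Fc' l' ul' vl'} in cr'.
case: cr' => vP vmin.
(* Moving the center of [v] to [c + t *: y'] changes the asymptotic bound by at most
   [- 2 t eps + t^2 |y'|^2], which for this [t] equals [- t eps - t^2 < 0], against minimality. *)
pose t := eps / (`|y'| ^+ 2 + 1).
have y0 : 0 < `|y'| ^+ 2 + 1 by rewrite ltr_wpDl ?sqr_ge0.
have t0 : 0 < t by rewrite divr_gt0.
have ty : t * (`|y'| ^+ 2 + 1) = eps by rewrite /t divfK ?gt_eqF.
have /ler_addgt0Pr : forall e, 0 < e -> r' <= r' - 2 * t * eps + t ^+ 2 * `|y'| ^+ 2 + e.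
  move=> e e0; have vn : \forall n \near \oo, `|v n - (c + t *: y')| ^+ 2 <=
      r' - 2 * t * eps + t ^+ 2 * `|y'| ^+ 2 + e.
    near=> n; rewrite opprD addrA normsqB normsqZ linearZr_LR /=.
    have : `|v n - c| ^+ 2 <= r' + e by near: n; exact: vP.
    have := (phiP n).2; rewrite -/(v n); set D := dot _ _ => /ltW De.
    have : t * eps <= t * D by rewrite ler_pM2l.
    by lra.
  by apply: le_trans (vmin _ _ vn); rewrite lerDl divr_ge0 ?sqr_ge0.
have : t * (t * (`|y'| ^+ 2 + 1)) = t * eps by rewrite ty.
have : 0 < t * eps by rewrite mulr_gt0.
have : 0 < t ^+ 2 by rewrite exprn_gt0.
by rewrite expr2; lra.
Unshelve. all: end_near. Qed.

End hilbert.

(** * Averaged operators *)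

Section operators.
Variables (R : realType) (H : completeNormedModType R) (dot : {dot H for idfun}).
Hypothesis H_hilbert : is_hilbert dot.

Lemma lipschitzP (f : H -> H) (k : R) : k.-lipschitz f ->
  forall x y, `|f x - f y| <= k * `|x - y|.
Proof. by move=> fk x y; apply: (fk (x, y)). Qed.

(** With [d = x - y] and [g] the difference of the residuals, [f x - f y = d - g] and averagedness
    reads [|d - a^-1 g| <= |d|]. Expanding the squares reduces both to [a^-1 |g|^2 <= 2 dot d g]. *)
Lemma averaged_gap (a : R) (f : H -> H) x y : averaged a f ->
  `|f x - f y| ^+ 2 + (a^-1 - 1) * `|(x - f x) - (y - f y)| ^+ 2 <= `|x - y| ^+ 2.
Proof.
move=> [/andP[a0 a1] /lipschitzP/(_ x y)]; rewrite mul1r.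
set g := (x - f x) - (y - f y).
have -> : f x - f y = (x - y) - g.
  by rewrite /g [in RHS]opprD opprK [in RHS]addrACA subKr addKr.
have -> : x + a^-1 *: (f x - x) - (y + a^-1 *: (f y - y)) = (x - y) - a^-1 *: g.
  rewrite opprD addrACA -scalerBr -scalerN; congr (_ + _ *: _).
  by rewrite /g [RHS]opprD -[x - f x]opprB -[y - f y]opprB !opprK.
move: (x - y) g => d g.
rewrite -ler_sqr ?nnegrE // !(normsqB H_hilbert) normsqZ linearZr_LR /=.
set D := dot _ _; set G := `|g| ^+ 2 => h.
have a'0 : 0 < a^-1 by rewrite invr_gt0.
suff : a^-1 * G <= 2 * D by lra.
rewrite -(ler_pM2l a'0); lra.
Qed.

Lemma averaged_nonexpansive (a : R) (f : H -> H) : averaged a f ->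
  forall x y, `|f x - f y| <= `|x - y|.
Proof.
move=> fa x y; rewrite -ler_sqr ?nnegrE //; apply: le_trans (averaged_gap x y fa).
case: fa => /andP[a0 a1] _.
by rewrite lerDl mulr_ge0 ?sqr_ge0 // subr_ge0 invf_ge1 // ltW.
Qed.

(** The variance is the exact defect in the convexity of the squared norm: the weighted cross terms
    add up to twice the squared norm of the barycenter. *)
Lemma convex_variance (m : nat) (w : 'I_m -> R) (u : 'I_m -> H) :
  \sum_(i < m) w i = 1 ->
  `|\sum_(i < m) w i *: u i| ^+ 2
    + \sum_(i < m) w i * `|u i - \sum_(j < m) w j *: u j| ^+ 2
  = \sum_(i < m) w i * `|u i| ^+ 2.
Proof.
move=> w1; set b := \sum_(j < m) w j *: u j.
under eq_bigr do rewrite (normsqB H_hilbert) mulrDr mulrBr.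
rewrite big_split /= sumrB -mulr_suml w1 mul1r.
have -> : \sum_(i < m) w i * (2 * dot (u i) b) = 2 * `|b| ^+ 2.
  rewrite H_hilbert {2}/b linear_sumlz mulr_sumr; apply: eq_bigr => i _.
  by rewrite linearZl_LR /= mulrCA.
by ring.
Qed.

Lemma cvg0_of_sqr_le (g : nat -> H) (d : nat -> R) (c : R) : 0 < c ->
  (forall n, c * `|g n| ^+ 2 <= d n) -> d @ \oo --> 0 -> g @ \oo --> 0.
Proof.
move=> c0 gd d0; apply/cvgr0Pnorm_le => eps eps0.
have ce : 0 < c * eps ^+ 2 by rewrite mulr_gt0 // exprn_gt0.
near=> n; rewrite -ler_sqr ?nnegrE ?(ltW eps0) // -(ler_pM2l c0).
apply: (le_trans (gd n)); near: n; exact: (cvgr_le _ d0).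
Unshelve. all: end_near. Qed.

End operators.

(** * The block iteration *)

Lemma last_activationP (m K : nat) (I : nat -> {set 'I_m}) (i : 'I_m) (n k : nat) :
  (n.+1 - K <= k <= n)%N -> i \in I k ->
  let l := last_activation K I i n in
  [/\ (n.+1 - K <= l <= n)%N, i \in I l
    & forall j, (l < j <= n)%N -> i \notin I j].
Proof.
move=> kn ik l.
have le_l j : (n.+1 - K <= j <= n)%N -> i \in I j -> (j <= l)%N.
  move=> jn ij; apply: (@leq_bigmax_seq _ _ _ id j) => //.
  by rewrite mem_index_iota ltnS.
have [ln il] : (n.+1 - K <= l <= n)%N /\ i \in I l.
  (* An empty maximum defaults to 0. If [l = 0], then [k <= l] makes [k = 0], so the given
     activation still proves the claim. *)
  have : l = 0%N \/ (n.+1 - K <= l <= n)%N /\ i \in I l.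
    rewrite /l /last_activation big_seq_cond.
    apply: (big_ind (fun j => j = 0%N \/ (n.+1 - K <= j <= n)%N /\ i \in I j)).
    - by left.
    - by move=> j1 j2 h1 h2; case: (leqP j1 j2).
    - by move=> j; rewrite mem_index_iota ltnS => /andP[jn ij]; right.
  case=> // l0; have := le_l k kn ik; rewrite l0 leqn0 => /eqP k0.
  by rewrite k0 in kn ik.
split=> // j /andP[lj jn]; apply/negP => ij.
suff /le_l/(_ ij) : (n.+1 - K <= j <= n)%N by rewrite leqNgt lj.
by rewrite jn andbT (leq_trans _ (ltnW lj)) //; case/andP: ln.
Qed.

(* Windows have length K + 1: K is the paper's K - 1, and the index p stands for
   the iteration n = p + K. *)
Section block_iteration.
Variables (R : realType) (H : completeNormedModType R) (dot : {dot H for idfun}).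
Hypothesis H_hilbert : is_hilbert dot.
Variables (m : nat) (omega : 'I_m -> R).
Hypotheses (omega_itv : forall i, 0 < omega i <= 1)
  (omega_sum : \sum_(i < m) omega i = 1).
Variables (T : 'I_m.+1 -> H -> H) (alpha : 'I_m.+1 -> R).
Hypothesis T_averaged : forall i, averaged (alpha i) (T i).
Variables (K : nat) (I : nat -> {set 'I_m}).
Hypotheses (I_neq0 : forall n, I n != finset.set0)
  (I_cover : forall n, (\bigcup_(k < K.+1) I (n + k)%N = [set: 'I_m])%SET).
Variable e : 'I_m.+1 -> nat -> H.
Hypotheses (e0_sum : (\sum_(K <= n <oo) `|e ord0 n|%:E < +oo)%E)
  (e_sum : forall i : 'I_m,
     (\sum_(K <= n <oo) `|e (lift ord0 i) (last_activation K.+1 I i n)|%:E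
        < +oo)%E).
Variables (x0 : H) (tinit : 'I_m -> H) (t : 'I_m -> nat -> H) (x : nat -> H).
Hypothesis x_iter : is_iteration T omega I e x0 tinit t x.

Local Notation Tj := (fun i : 'I_m => T (lift ord0 i)).
Local Notation avg u := (\sum_(i < m) omega i *: u i).

Let omega_gt0 i : 0 < omega i. Proof. by case/andP: (omega_itv i). Qed.
Let omega_ge0 i : 0 <= omega i. Proof. exact: ltW. Qed.
Let T1 i y z : `|T i y - T i z| <= `|y - z|.
Proof. exact: averaged_nonexpansive (T_averaged i) _ _. Qed.

Lemma normr_avg (u : 'I_m -> H) : `|avg u| <= \sum_(i < m) omega i * `|u i|.
Proof.
apply: le_trans (ler_norm_sum _ _ _) _; apply: ler_sum => i _.
by rewrite normrZ ger0_norm.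
Qed.

Lemma avgB (u v : 'I_m -> H) : avg u - avg v = avg (fun i => u i - v i).
Proof. by rewrite -sumrB; apply: eq_bigr => i _; rewrite scalerBr. Qed.

Lemma avg_cst (z : H) : avg (fun=> z) = z.
Proof. by rewrite -scaler_suml omega_sum scale1r. Qed.

Lemma cvg_avg (u : 'I_m -> nat -> H) (l : 'I_m -> H) :
  (forall i, u i @ \oo --> l i) -> avg (fun i => u i n) @[n --> \oo] --> avg l.
Proof.
by move=> ul; apply: cvg_big => [|i _]; [exact: add_continuous|exact: cvgZr].
Qed.

(** One argument per operator, since each acts on the iterate of its own last activation; the
    diagonal [one_step] is the operator behind [solutions]. *)
Definition step (q : 'I_m -> H) : H := T ord0 (avg (fun i => Tj i (q i))).

Definition one_step (y : H) : H := step (fun=> y).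

Lemma step_nonexpansive (q q' : 'I_m -> H) :
  `|step q - step q'| <= \sum_(i < m) omega i * `|q i - q' i|.
Proof.
apply: le_trans (T1 _ _ _) _; rewrite avgB; apply: le_trans (normr_avg _) _.
by apply: ler_sum => i _; rewrite ler_wpM2l.
Qed.

Lemma one_step_nonexpansive : nonexpansive one_step.
Proof.
move=> [y z] _ /=; rewrite mul1r; apply: le_trans (step_nonexpansive _ _) _.
by rewrite -mulr_suml omega_sum mul1r.
Qed.

(** * Delayed iterates and the perturbed recursion *)

Let l i p := last_activation K.+1 I i (p + K).

Lemma last_blockP i p : [/\ (p <= l i p <= p + K)%N, i \in I (l i p)
  & forall j, (l i p < j <= p + K)%N -> i \notin I j].
Proof.
have : i \in (\bigcup_(k < K.+1) I (p + k)%N)%SET by rewrite I_cover inE.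
case/bigcupP => k _ ik.
have pE : ((p + K).+1 - K.+1 = p)%N by rewrite subSS addnK.
have := @last_activationP m K.+1 I i (p + K) (p + k); rewrite pE; apply => //.
by rewrite leq_addr leq_add2l -ltnS ltn_ord.
Qed.

Lemma last_block_id i p : i \in I (p + K)%N -> l i p = (p + K)%N.
Proof.
move=> ip; have [/andP[_ le_l] _ notin] := last_blockP i p.
apply/eqP; rewrite eqn_leq le_l leqNgt; apply/negP => lt_l.
by have := notin (p + K)%N; rewrite lt_l leqnn ip => /(_ isT).
Qed.

Lemma last_block_oo i : l i p @[p --> \oo] --> \oo.
Proof.
by apply: cvgn_oo_ge => p; case: (last_blockP i p) => /andP[].
Qed.

(** The index [i] is inactive after [l i p], so the value computed there is carried along; the
    induction is on the elapsed time. *)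
Lemma block_valueE i p : t i (p + K)%N = Tj i (x (l i p)) + e (lift ord0 i) (l i p).
Proof.
have [/andP[_ le_l] il notin] := last_blockP i p.
case: x_iter => _ t_rec _.
rewrite -(subnKC le_l); move: (p + K - l i p)%N (subnKC le_l) => d ld.
have : (l i p + d <= p + K)%N by rewrite ld.
elim: d {ld} => [|d IH] ldp; first by rewrite addn0 t_rec il.
rewrite addnS t_rec -addnS ifN; first by rewrite IH // ltnW // -addnS.
by apply: notin; rewrite ldp andbT -addSnnS leq_addr.
Qed.

Let q p i := x (l i p).
Let err p := `|e ord0 (p + K)%N| + \sum_(i < m) omega i * `|e (lift ord0 i) (l i p)|.

(** Block errors occur inside [T ord0], whose nonexpansiveness moves them outside with weights
    [omega i]. *)
Lemma iter_step p : `|x (p + K).+1 - step (q p)| <= err p.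
Proof.
case: x_iter => _ _ ->; rewrite /err addrAC.
apply: le_trans (ler_normD _ _) _; rewrite [leRHS]addrC lerD2r.
apply: le_trans (T1 _ _ _) _; rewrite avgB; apply: le_trans (normr_avg _) _.
by apply: ler_sum => i _; rewrite block_valueE addrC addKr.
Qed.

Lemma err_tails : exists s : nat -> R, [/\ nonincreasing_seq s,
  forall n, 0 <= s n & forall p, err p = s (p + K)%N - s (p + K).+1].
Proof.
have [s0 [s0_mono s0_ge0 s0E]] := summable_tails (fun n => normr_ge0 (e ord0 n)) e0_sum.
have /choice[s_ s_P] : forall i, exists s : nat -> R, [/\ nonincreasing_seq s,
    forall n, 0 <= s n & forall n, (K <= n)%N -> s n.+1
      + `|e (lift ord0 i) (last_activation K.+1 I i n)| = s n].
  by move=> i; apply: summable_tails (e_sum i) => n.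
exists (fun n => s0 n + \sum_(i < m) omega i * s_ i n); split.
- move=> a b ab; apply: lerD; first exact: s0_mono.
  by apply: ler_sum => i _; rewrite ler_wpM2l //; case: (s_P i) => mono _ _; exact: mono.
- move=> n; rewrite addr_ge0 // sumr_ge0 // => i _; rewrite mulr_ge0 //.
  by case: (s_P i).
- move=> p; rewrite opprD addrACA -sumrB; congr (_ + _).
    by rewrite -(s0E (p + K)%N) ?leq_addl // addrC addKr.
  apply: eq_bigr => i _; have [_ _ <-] := s_P i; last exact: leq_addl.
  by rewrite -mulrBr addrC addKr.
Qed.

Lemma err_cvg0 : err @ \oo --> 0.
Proof.
have [s [s_mono s_ge0 sE]] := err_tails.
have s_cvg : cvgn s by apply: nonincreasing_is_cvgn => //; exists 0 => _ [n _ <-].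
rewrite (_ : err = (fun p => s (p + K)%N - s (p + K.+1)%N)); last first.
  by apply/funext => p; rewrite sE addnS.
rewrite -(subrr (limn s)); apply: cvgB.
  by rewrite (cvg_shiftn K).
by rewrite (cvg_shiftn K.+1).
Qed.

Lemma active_block p : exists i, l i p = (p + K)%N.
Proof.
have /finset.set0Pn[i ip] := I_neq0 (p + K)%N.
by exists i; exact: last_block_id.
Qed.

Lemma omega_lower : exists2 w : R, 0 < w <= 1 & forall i, w <= omega i.
Proof.
exists (\big[Num.min/1]_(i < m) omega i) => [|i]; last exact: bigmin_le.
by rewrite bigmin_le_id andbT; apply: lt_bigmin.
Qed.

Lemma dist_solution_cvg z : one_step z = z -> cvgn (fun n => `|x n - z|).
Proof.
move=> zF; have [w w01 wle] := omega_lower.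
have [s [s_mono s_ge0 sE]] := err_tails.
apply: (@window_cvg _ K w _ s) => // p B xB.
rewrite -sE.
have : `|step (q p) - z| <= \sum_(i < m) omega i * `|q p i - z|.
  by rewrite -[X in `|step _ - X|]zF; exact: step_nonexpansive.
have qB i : `|q p i - z| <= B.
  have [/andP[pl lp] _ _] := last_blockP i p.
  by rewrite /q -(subnKC pl); apply: xB; rewrite leq_subLR.
have [i ip] := active_block p.
have -> : `|x (p + K)%N - z| = `|q p i - z| by rewrite /q ip.
rewrite (bigD1 i) //=.
have : \sum_(j < m | j != i) omega j * `|q p j - z| <= (1 - omega i) * B.
  rewrite -omega_sum [X in X - _](bigD1 i) //= addrAC subrr add0r mulr_suml.
  by apply: ler_sum => j _; rewrite ler_wpM2l.
have := ler_normD (x (p + K).+1 - step (q p)) (step (q p) - z); rewrite subrKA.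
(* Lowers the weight of the current distance from [omega i] to the uniform [w], shifting the
   difference onto [B]. *)
have : 0 <= (omega i - w) * (B - `|q p i - z|) by rewrite mulr_ge0 ?subr_ge0.
have := iter_step p.
by lra.
Qed.

(** * Vanishing of the gaps in the averagedness inequalities *)

Lemma dot_inj (y y' : H) : (forall h, dot y h = dot y' h) -> y = y'.
Proof.
move=> yy'; apply/eqP; rewrite -subr_eq0 -normr_eq0 -sqrf_eq0 H_hilbert.
by rewrite linearBl /= yy' subrr.
Qed.

(* Pairing with an arbitrary vector turns an identity in H, to which [ring] does
   not apply, into one in R. *)
Ltac dot_ring :=
  apply: dot_inj => ?; rewrite ?fctE ?(linearBl, linearDl, linearNl) /=; ring.

Lemma averaged_coef_gt0 i : 0 < (alpha i)^-1 - 1.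
Proof. by case: (T_averaged i) => /andP[a0 a1] _; rewrite subr_gt0 invf_gt1. Qed.

(** Chains [averaged_gap] for [T ord0] at the two averages, [convex_variance] for the differences of
    images, and [averaged_gap] for each inner operator, keeping every remainder. *)
Lemma step_gap z (u : 'I_m -> H) : one_step z = z ->
  `|step u - z| ^+ 2
    + ((alpha ord0)^-1 - 1) * `|(avg (fun i => Tj i (u i)) - step u)
                                - (avg (fun i => Tj i z) - z)| ^+ 2
    + \sum_(i < m) omega i *
        (`|Tj i (u i) - Tj i z - avg (fun j => Tj j (u j) - Tj j z)| ^+ 2
        + ((alpha (lift ord0 i))^-1 - 1)
          * `|(u i - Tj i (u i)) - (z - Tj i z)| ^+ 2)
  <= \sum_(i < m) omega i * `|u i - z| ^+ 2.
Proof.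
move=> zF; pose v i := Tj i (u i) - Tj i z.
have := averaged_gap H_hilbert (avg (fun i => Tj i (u i))) (avg (fun i => Tj i z))
  (T_averaged ord0).
rewrite -/(step u) -[T ord0 _]/(one_step z) zF avgB -/v.
have := convex_variance H_hilbert v omega_sum.
pose g i := ((alpha (lift ord0 i))^-1 - 1) * `|(u i - Tj i (u i)) - (z - Tj i z)| ^+ 2.
have : \sum_(i < m) omega i * `|v i| ^+ 2 + \sum_(i < m) omega i * g i
   <= \sum_(i < m) omega i * `|u i - z| ^+ 2.
  rewrite -big_split; apply: ler_sum => i _ /=; rewrite -mulrDr ler_wpM2l //.
  exact: averaged_gap (T_averaged _).
have -> : \sum_(i < m) omega i * (`|v i - avg v| ^+ 2 + g i) =
    \sum_(i < m) omega i * `|v i - avg v| ^+ 2 + \sum_(i < m) omega i * g i.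
  by rewrite -big_split; apply: eq_bigr => i _; rewrite mulrDr.
by lra.
Qed.

Lemma iter_diff : x (p + K).+1 - step (q p) @[p --> \oo] --> 0.
Proof.
apply/cvgr0Pnorm_le => eps eps0; near=> p; apply: (le_trans (iter_step p)).
by near: p; exact: (cvgr_le _ err_cvg0).
Unshelve. all: end_near. Qed.

(** The two outer quantities of [step_gap] tend to the same limit, the square of [lim |x n - z|], so
    their difference [d] squeezes every remainder to 0. *)
Lemma step_gaps_cvg0 z : one_step z = z ->
  [/\ forall i, (q p i - Tj i (q p i)) - (z - Tj i z) @[p --> \oo] --> 0,
    forall i, (Tj i (q p i) - Tj i z) - avg (fun i => Tj i (q p i) - Tj i z)
      @[p --> \oo] --> 0
    & (avg (fun i => Tj i (q p i)) - step (q p)) - (avg (fun i => Tj i z) - z)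
      @[p --> \oo] --> 0].
Proof.
move=> zF; have /cvg_ex[a xa] := dist_solution_cvg zF.
have qa i : `|q p i - z| @[p --> \oo] --> a.
  exact: (cvg_comp (l i) (fun n => `|x n - z|) (@last_block_oo i) xa).
have sa : `|step (q p) - z| @[p --> \oo] --> a.
  have x'a : `|x (p + K).+1 - z| @[p --> \oo] --> a.
    apply: (cvg_comp (fun p => (p + K).+1) (fun n => `|x n - z|) _ xa).
    by apply: cvgn_oo_ge => p; rewrite -addnS leq_addr.
  apply: (@squeeze_cvgr _ _ _ _ (fun p => `|x (p + K).+1 - z| - err p)
    (fun p => `|x (p + K).+1 - z| + err p)).
  - near=> p; have := iter_step p.
    have := ler_normD (x (p + K).+1 - step (q p)) (step (q p) - z).
    have := ler_normD (step (q p) - x (p + K).+1) (x (p + K).+1 - z).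
    rewrite !subrKA [`|step _ - x _|]distrC => h1 h2 h3.
    by apply/andP; split; lra.
  - by rewrite -[X in _ --> X]subr0; apply: cvgB => //; exact: err_cvg0.
  - by rewrite -[X in _ --> X]addr0; apply: cvgD => //; exact: err_cvg0.
pose d p := \sum_(i < m) omega i * `|q p i - z| ^+ 2 - `|step (q p) - z| ^+ 2.
have d0 : d @ \oo --> 0.
  rewrite -(subrr (a ^+ 2)); apply: cvgB; last exact: cvg_sqr.
  rewrite -[X in _ --> X]mul1r -omega_sum mulr_suml.
  apply: cvg_big => [|i _]; first exact: add_continuous.
  by apply: cvgMr; exact: cvg_sqr.
have gap p := step_gap (q p) zF.
have T0_ge0 p : 0 <= ((alpha ord0)^-1 - 1) * `|(avg (fun i => Tj i (q p i)) - step (q p))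
    - (avg (fun i => Tj i z) - z)| ^+ 2.
  by rewrite mulr_ge0 ?sqr_ge0 // ltW // averaged_coef_gt0.
pose g p i := ((alpha (lift ord0 i))^-1 - 1)
          * `|(q p i - Tj i (q p i)) - (z - Tj i z)| ^+ 2.
have g_ge0 p i : 0 <= g p i.
  by rewrite mulr_ge0 ?sqr_ge0 // ltW // averaged_coef_gt0.
pose h p i := `|Tj i (q p i) - Tj i z - avg (fun i => Tj i (q p i) - Tj i z)| ^+ 2.
have h_ge0 p i : 0 <= h p i by exact: sqr_ge0.
have sum_ge0 p (P : pred 'I_m) : 0 <= \sum_(i < m | P i) omega i * (h p i + g p i).
  by rewrite sumr_ge0 // => i _; rewrite mulr_ge0 // addr_ge0.
have le_d p i : omega i * (h p i + g p i) <= d p.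
  have := gap p; rewrite -/(g p) /= [X in _ + X <= _](bigD1 i) //=.
  rewrite -/(h p i) -/(g p i) /d; have := sum_ge0 p (fun j => j != i).
  have := T0_ge0 p.
  by rewrite /h /g; lra.
split.
- move=> i; apply: (@cvg0_of_sqr_le _ _ _ d (omega i * ((alpha (lift ord0 i))^-1 - 1))) => //.
    by rewrite mulr_gt0 // averaged_coef_gt0.
  move=> p; apply: le_trans (le_d p i); rewrite -mulrA ler_wpM2l //.
  by rewrite lerDr.
- move=> i; apply: (@cvg0_of_sqr_le _ _ _ d (omega i)) => // p.
  by apply: le_trans (le_d p i); rewrite ler_wpM2l // lerDl.
- apply: (@cvg0_of_sqr_le _ _ _ d ((alpha ord0)^-1 - 1)) => //.
    exact: averaged_coef_gt0.
  move=> p; have := gap p; have := sum_ge0 p predT.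
  by rewrite /d /h /g /=; lra.
Unshelve. all: end_near. Qed.

(** * Residuals, cluster points and rates, given a solution *)

Section with_solution.
Variable z : H.
Hypothesis zF : one_step z = z.

(** The two vanishing gaps of an index [j] add up to [q p j - z] minus an average independent of
    [j]; hence all delayed points merge, and one of them is the current iterate. *)
Lemma last_block_dist i : q p i - x (p + K)%N @[p --> \oo] --> 0.
Proof.
have [g1 g2 _] := step_gaps_cvg0 zF.
have qq j k : q p j - q p k @[p --> \oo] --> 0.
  apply: (cvgn_ext (cvgB (cvgD (g1 j) (g2 j)) (cvgD (g1 k) (g2 k)))) => [p /=|].
    dot_ring.
  by rewrite addr0 subrr.
have S0 : \sum_(j < m) `|q p i - q p j| @[p --> \oo] --> (0 : R).
  rewrite [X in _ --> X](_ : 0 = \sum_(j < m) (0 : R)); last by rewrite big1.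
  apply: cvg_big => [|j _]; first exact: add_continuous.
  by rewrite -(normr0 H); apply: cvg_norm; exact: qq.
apply/cvgr0Pnorm_le => eps eps0; near=> p.
apply: (@le_trans _ _ (\sum_(j < m) `|q p i - q p j|)).
  (* The active index varies with [p], which is why the bound sums over all indices. *)
  have [j jp] := active_block p.
  rewrite -jp -/(q p j) [leRHS](bigD1 j) //= lerDl.
  by apply: sumr_ge0.
by near: p; exact: (cvgr_le _ S0).
Unshelve. all: end_near. Qed.

Lemma residual_cvg i : x n - Tj i (x n) @[n --> \oo] --> z - Tj i z.
Proof.
rewrite -(cvg_shiftn K) /=.
have [/(_ i) g1 _ _] := step_gaps_cvg0 zF.
have d0 := last_block_dist i.
have Td0 : Tj i (q p i) - Tj i (x (p + K)%N) @[p --> \oo] --> 0.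
  apply/cvgr0Pnorm_le => eps eps0; near=> p; apply: (le_trans (T1 _ _ _)).
  by near: p; move/cvgr0Pnorm_le : d0; apply.
apply: (cvgn_ext (cvgD (cvgD g1 (cvgB Td0 d0)) (cvg_cst (z - Tj i z)))) => [p /=|].
  dot_ring.
by rewrite subr0 !add0r.
Unshelve. all: end_near. Qed.

(** In the sum of the averaged inner gaps and the outer gap the terms in [z] cancel, leaving
    [avg (q p) - step (q p)]; and [avg (q p)] is close to the current iterate. *)
Lemma step_dist : step (q p) - x (p + K)%N @[p --> \oo] --> 0.
Proof.
have [g1 _ g0] := step_gaps_cvg0 zF.
have A := cvg_avg last_block_dist; have B := cvg_avg g1.
apply: (cvgn_ext (cvgB A (cvgD B g0))) => [p /=|]; last first.
  by rewrite !big1 ?addr0 ?subr0 // => i _; rewrite scaler0.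
rewrite !fctE -!avgB !avg_cst; dot_ring.
Qed.

Lemma iter_fixed_cvg : x n - one_step (x n) @[n --> \oo] --> 0.
Proof.
rewrite -(cvg_shiftn K) /=.
have S0 : \sum_(i < m) omega i * `|q p i - x (p + K)%N| @[p --> \oo] --> (0 : R).
  rewrite [X in _ --> X](_ : 0 = \sum_(i < m) omega i * 0); last first.
    by rewrite big1 // => i _; rewrite mulr0.
  apply: cvg_big => [|i _]; first exact: add_continuous.
  by apply: cvgMr; rewrite -(normr0 H); apply: cvg_norm; exact: last_block_dist.
have D0 : step (q p) - one_step (x (p + K)%N) @[p --> \oo] --> 0.
  apply/cvgr0Pnorm_le => eps eps0; near=> p.
  apply: (le_trans (step_nonexpansive _ _)).
  by near: p; exact: (cvgr_le _ S0).
apply: (cvgn_ext (cvgB D0 step_dist)) => [p /=|]; last by rewrite subrr.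
dot_ring.
Unshelve. all: end_near. Qed.

Lemma iter_bounded : exists M : R, forall n, `|x n| <= M.
Proof.
have [M xM] := cvgn_bounded (dist_solution_cvg zF).
exists (M + `|z|) => n; rewrite -[x n](subrK z).
by apply: le_trans (ler_normD _ _) _; rewrite lerD2r.
Qed.

(** The cluster point [y] is fixed since the residual vanishes; then the distances to [y] converge,
    and their limit is 0 along [psi]. *)
Lemma iter_cvg_of_subseq (psi : nat -> nat) y :
  psi n @[n --> \oo] --> \oo -> x (psi n) @[n --> \oo] --> y ->
  one_step y = y /\ x n @[n --> \oo] --> y.
Proof.
move=> psi_oo xy.
have yF : one_step y = y.
  have Fxy : one_step (x (psi n)) @[n --> \oo] --> one_step y.
    apply/cvgrPdist_le => eps eps0; near=> n.
    have := lipschitzP one_step_nonexpansive y (x (psi n)).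
    rewrite /= mul1r => /le_trans; apply.
    by near: n; move/cvgrPdist_le : xy; apply.
  apply/eqP; rewrite eq_sym -subr_eq0; apply/eqP.
  apply: (cvg_unique (@norm_hausdorff _ H) (cvgB xy Fxy)).
  exact: (cvg_comp psi _ psi_oo iter_fixed_cvg).
split=> //; have /cvg_ex[a xa] := dist_solution_cvg yF.
have a0 : a = 0.
  have xpa := cvg_comp psi _ psi_oo xa.
  have xp0 : `|x (psi n) - y| @[n --> \oo] --> `|y - y|.
    by apply: cvg_norm; apply: cvgB => //; exact: cvg_cst.
  rewrite subrr normr0 in xp0.
  exact: (cvg_unique (@Rhausdorff R) xpa xp0).
rewrite a0 in xa.
have x0' : x n - y @[n --> \oo] --> 0 by apply/norm_cvg0P.
by apply: (cvgn_ext (cvgD x0' (cvg_cst y))) => [n /=|]; rewrite ?subrK ?add0r.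
Unshelve. all: end_near. Qed.

Lemma iter_cvg_of_demicompact : (exists i, demicompact (T i)) ->
  exists2 y, one_step y = y & x n @[n --> \oo] --> y.
Proof.
have [M xM] := iter_bounded.
have bounded u B : (forall n, `|u n| <= B) -> bounded_fun (u : nat -> H).
  move=> uB; exists B; split; first exact: num_real.
  by move=> r /ltW Br n _ /=; exact: le_trans (uB n) Br.
suff subseq i : demicompact (T i) ->
    exists2 psi : nat -> nat, psi n @[n --> \oo] --> \oo &
      exists y : H, x (psi n) @[n --> \oo] --> y.
  move=> [i Ti]; have [psi psi_oo [y xy]] := subseq i Ti.
  by have [yF xcvg] := iter_cvg_of_subseq psi_oo xy; exists y.
case: (unliftP ord0 i) => [j ->|->] Td.
  have [|phi phi_incr /cvg_ex[y xy]] := Td _ (bounded _ _ xM).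
    by apply/cvg_ex; exists (z - Tj j z); exact: residual_cvg.
  exists phi; last by exists y.
  exact/cvgn_oo_ge/increasing_seq_ge.
(* For the outer operator, demicompactness is applied to its own inputs [Y p], whose residuals tend
   to [b], rather than to the iterates. *)
pose Y p := avg (fun i => Tj i (q p i)).
pose b := avg (fun i => Tj i z) - z.
have Yb : Y p - step (q p) @[p --> \oo] --> b.
  have [_ _ g0] := step_gaps_cvg0 zF.
  apply: (cvgn_ext (cvgD g0 (cvg_cst b))) => [p /=|]; last by rewrite add0r.
  by rewrite subrK.
have [C YC] : exists C, forall p, `|Y p - step (q p)| <= C.
  by apply: cvgn_bounded; apply/cvg_ex; exists `|b|; exact: cvg_norm.
have stepM p : `|step (q p)| <= M + `|z| + `|z|.
  rewrite -[step _](subrK z) (le_trans (ler_normD _ _)) // lerD2r.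
  rewrite -[X in `|_ - X|]zF (le_trans (step_nonexpansive _ _)) //.
  rewrite -[leRHS]mul1r -omega_sum mulr_suml; apply: ler_sum => i' _.
  rewrite ler_wpM2l // (le_trans (ler_normB _ _)) // lerD2r.
  exact: xM.
have YM p : `|Y p| <= C + (M + `|z| + `|z|).
  by rewrite -[Y p](subrK (step (q p))) (le_trans (ler_normD _ _)) // lerD.
have [|phi phi_incr /cvg_ex[y Yy]] := Td _ (bounded _ _ YM).
  by apply/cvg_ex; exists b; exact: Yb.
have phi_oo := cvgn_oo_ge (increasing_seq_ge phi_incr).
(* [step (q p)] approximates the next iterate [x (p + K).+1], so along [phi] these iterates behave
   like [Y - (Y - step q)] and tend to [y - b]. *)
exists (fun n => (phi n + K).+1).
  apply: cvgn_oo_ge => n; apply: leq_trans (increasing_seq_ge phi_incr n) _.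
  by rewrite -addnS leq_addr.
exists (y - b).
have Yb' : Y (phi n) - step (q (phi n)) @[n --> \oo] --> b.
  exact: (cvg_comp phi (fun p => Y p - step (q p)) phi_oo Yb).
have dx : x (phi n + K).+1 - step (q (phi n)) @[n --> \oo] --> 0.
  exact: (cvg_comp phi (fun p => x (p + K).+1 - step (q p)) phi_oo iter_diff).
apply: (cvgn_ext (cvgB Yy (cvgB Yb' dx))) => [n /=|]; last by rewrite subr0.
dot_ring.
Qed.

(** A single contraction suffices because the other operators do not increase distances; the uniform
    bound [B] fits the window hypothesis of [window_linear]. *)
Lemma step_contraction : (exists i, banach_contraction (T i)) ->
  exists2 k : R, 0 <= k < 1 & forall u u' B,
    (forall i, `|u i - u' i| <= B) -> `|step u - step u'| <= k * B.
Proof.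
move=> [i [k /andP[k0 k1] /lipschitzP Tk]].
have avg_le (u u' : 'I_m -> H) B : (forall j, `|u j - u' j| <= B) ->
    \sum_(j < m) omega j * `|u j - u' j| <= B.
  move=> uB; rewrite -[leRHS]mul1r -omega_sum mulr_suml.
  by apply: ler_sum => j _; rewrite ler_wpM2l.
case: (unliftP ord0 i) Tk => [j ->|->] Tk; last first.
  exists k => [|u u' B uB]; first by rewrite k0.
  apply: le_trans (Tk _ _) _; rewrite ler_wpM2l // avgB.
  apply: le_trans (normr_avg _) _.
  apply: (avg_le (fun i => Tj i (u i)) (fun i => Tj i (u' i))) => a.
  exact: le_trans (T1 _ _ _) (uB a).
(* An inner contraction gains only on its own share: [(1 - omega j) + omega j * k]. *)
exists (1 - omega j * (1 - k)) => [|u u' B uB].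
  have /andP[w0 w1] := omega_itv j.
  have : omega j * k < omega j * 1 by rewrite ltr_pM2l.
  have : 0 <= omega j * k by rewrite mulr_ge0.
  by move=> h1 h2; apply/andP; split; lra.
apply: le_trans (T1 _ _ _) _; rewrite avgB; apply: le_trans (normr_avg _) _.
rewrite (bigD1 j) //=.
have : omega j * `|Tj j (u j) - Tj j (u' j)| <= omega j * (k * B).
  by rewrite ler_wpM2l // (le_trans (Tk _ _)) // ler_wpM2l.
have : \sum_(i < m | i != j) omega i * `|Tj i (u i) - Tj i (u' i)| <= (1 - omega j) * B.
  rewrite -omega_sum [X in X - _](bigD1 j) //= addrAC subrr add0r mulr_suml.
  by apply: ler_sum => a _; rewrite ler_wpM2l // (le_trans (T1 _ _ _)).
by rewrite /=; lra.
Qed.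

Lemma iter_linear_cvg : (forall i n, e i n = 0) ->
  (exists i, banach_contraction (T i)) ->
  (forall y, one_step y = y -> y = z) /\ linear_cvg x z.
Proof.
move=> e0 /step_contraction[k k01 stepk]; split=> [y yF|].
  have := stepk (fun=> y) (fun=> z) `|y - z| (fun=> lexx _).
  rewrite -/(one_step y) -/(one_step z) yF zF => h.
  apply/eqP; rewrite -subr_eq0 -normr_eq0 eq_le normr_ge0 andbT.
  case/andP: k01 => _ k1.
  by rewrite -(ler_pM2l (_ : 0 < 1 - k)) ?subr_gt0 //; lra.
apply: (@window_linear _ K k) => // p B xB.
have -> : x (p + K).+1 = step (q p).
  apply/eqP; rewrite -subr_eq0 -normr_le0; apply: le_trans (iter_step p) _.
  by rewrite /err e0 normr0 add0r big1 // => i _; rewrite e0 normr0 mulr0.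
rewrite -[X in `|_ - X|]zF; apply: stepk => i.
have [/andP[pl lp] _ _] := last_blockP i p.
by rewrite /q -(subnKC pl); apply: xB; rewrite leq_subLR.
Qed.

End with_solution.

End block_iteration.

Theorem corollary3p4 (R : realType) (H : completeNormedModType R)
  (dot : {dot H for idfun}) (H_hilbert : is_hilbert dot)
  (m : nat) (m_gt0 : (0 < m)%N)
  (omega : 'I_m -> R) (omega_itv : forall i, 0 < omega i <= 1)
  (omega_sum : \sum_(i < m) omega i = 1)
  (T : 'I_m.+1 -> H -> H) (alpha : 'I_m.+1 -> R)
  (T_averaged : forall i, averaged (alpha i) (T i))
  (sol_exists : solutions T omega !=set0)
  (K : nat) (K_gt0 : (0 < K)%N)
  (I : nat -> {set 'I_m}) (I_neq0 : forall n, I n != finset.set0)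
  (I_cover : forall n, (\bigcup_(k < K) I (n + k)%N = [set: 'I_m])%SET)
  (e : 'I_m.+1 -> nat -> H)
  (e0_sum : (\sum_(K.-1 <= n <oo) `|e ord0 n|%:E < +oo)%E)
  (e_sum : forall i : 'I_m,
     (\sum_(K.-1 <= n <oo) `|e (lift ord0 i) (last_activation K I i n)|%:E
        < +oo)%E)
  (x0 : H) (tinit : 'I_m -> H) (t : 'I_m -> nat -> H) (x : nat -> H)
  (x_iter : is_iteration T omega I e x0 tinit t x) :
  [/\ forall z, solutions T omega z -> forall i : 'I_m,
        (x n - T (lift ord0 i) (x n)) @[n --> \oo] --> z - T (lift ord0 i) z,
      exists2 z, solutions T omega z & weak_cvg dot x z,
      (exists i, demicompact (T i)) ->
        exists2 z, solutions T omega z & x n @[n --> \oo] --> z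
    & (forall i n, e i n = 0) -> (exists i, banach_contraction (T i)) ->
        exists2 z, solutions T omega = [set z] & linear_cvg x z].
Proof.
(* From here [K] is the window length minus one, and membership in [solutions] is convertible to
   [one_step z = z]. *)
case: K K_gt0 I_cover e0_sum e_sum => // K _ I_cover e0_sum e_sum.
have [z zF] := sol_exists; split.
- move=> y yF i.
  exact: (residual_cvg H_hilbert omega_itv omega_sum T_averaged I_neq0 I_cover
    e0_sum e_sum x_iter yF).
- have [M xM] := iter_bounded H_hilbert omega_itv omega_sum T_averaged I_neq0 I_cover
    e0_sum e_sum x_iter zF.
  apply: (weak_cvg_of_fejer H_hilbert
    (one_step_nonexpansive H_hilbert omega_itv omega_sum T_averaged) xM).
    exact: (iter_fixed_cvg H_hilbert omega_itv omega_sum T_averaged I_neq0 I_cover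
      e0_sum e_sum x_iter zF).
  move=> y yF; exact: (dist_solution_cvg H_hilbert omega_itv omega_sum T_averaged I_neq0 I_cover
    e0_sum e_sum x_iter yF).
- exact: (iter_cvg_of_demicompact H_hilbert omega_itv omega_sum T_averaged I_neq0 I_cover
    e0_sum e_sum x_iter zF).
- move=> e0 Tc.
  have [uniq lin] := iter_linear_cvg H_hilbert omega_itv omega_sum T_averaged I_cover
    x_iter zF e0 Tc.
  exists z => //; apply/seteqP; split => y /=; first exact: uniq.
  by move->.
Qed.
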